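(* Consider probabilistic direct search (PDS, as described in the context) with $f:\mathbb{R}^n\to\mathbb{R}$ differentiable and convex on $\mathbb{R}^n$. Let $p_*=\dfrac{\log\gamma}{\log(\theta^{-1}\gamma)}$. Suppose that $\{\mathfrak{D}_k\}$ is a sequence of $p$-probabilistic ascent sets with $p>p_*$. Let $\mu:\mathbb{R}^n\to(-\infty,\infty]$ be a lower semicontinuous function with $\mu(x_0)>0$ that is locally Lipschitz continuous at $x_0$. Then there exist constants $C>0$ and $\overline{\zeta}>0$ such that the function $$\Psi(\zeta)=\mathbb{P}\Big(\inf_{k\ge 0}\mu(X_k)\ge(1-\zeta)\,\mu(x_0)\Big)$$ satisfies $$\Psi(\zeta)\ge C\,\zeta^{\frac{\log p}{\log\theta}}\quad\text{for all }\zeta\in(0,\overline{\zeta}).$$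
   Context: PDS. Fix $n\ge 1$, an objective $f:\mathbb{R}^n\to\mathbb{R}$, a deterministic starting point $x_0\in\mathbb{R}^n$, a deterministic initial step size $\alpha_0>0$, constants $\theta\in(0,1)$ and $\gamma\in[1,\infty)$, and a forcing function $\rho:(0,\infty)\to(0,\infty)$, which is nondecreasing with $\rho(\alpha)=o(\alpha)$ as $\alpha\to 0^+$. On a probability space $(\Omega,\mathcal{F},\mathbb{P})$, PDS generates random polling direction sets $\mathfrak{D}_k$, random iterates $X_k$ and random step sizes $A_k$, $k\ge 0$, with $X_0=x_0$, $A_0=\alpha_0$, as follows. For each $k\ge 0$, $\mathfrak{D}_k$ is nonempty and consists of finitely many random vectors in $\mathbb{R}^n$ of Euclidean norm $1$. If some $d\in\mathfrak{D}_k$ satisfies $f(X_k)-f(X_k+A_kd)>\rho(A_k)$, then $X_{k+1}=X_k+A_kd_k$ for some $d_k\in\mathfrak{D}_k$ satisfying this inequality (the selection rule is unspecified and may involve additional randomness) and $A_{k+1}=\gamma A_k$; otherwise $X_{k+1}=X_k$ and $A_{k+1}=\theta A_k$. Filtration: $\mathcal{F}_{-1}=\{\emptyset,\Omega\}$ and $\mathcal{F}_k=\sigma(\mathfrak{D}_0,X_1,\dots,\mathfrak{D}_k,X_{k+1})$ for $k\ge 0$. Equalities and inequalities involving conditional probabilities given a $\sigma$-algebra are understood almost surely. Cosine measure: for a finite nonempty set $\mathcal{D}$ of nonzero vectors and $v\ne 0$, $\operatorname{cm}(\mathcal{D},v)=\max_{d\in\mathcal{D}}\frac{d^{\mathsf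 T}v}{\|d\|\|v\|}$; $\operatorname{cm}(\mathcal{D},0)$ is defined to be an arbitrary fixed constant in $[-1,1]$. Probabilistic ascent: for $f$ continuously differentiable (automatic when $f$ is real-valued, differentiable and convex), let $G_k=\nabla f(X_k)$. For $p\in[0,1]$, $\{\mathfrak{D}_k\}$ is a sequence of $p$-probabilistic ascent sets if $\mathbb{P}(\operatorname{cm}(\mathfrak{D}_k,-G_k)\le 0\mid\mathcal{F}_{k-1})\ge p\,\mathbf{1}(G_k\ne 0)$ for each $k\ge 0$, where $\mathbf{1}$ denotes the indicator of an event. Locally Lipschitz continuous at $x_0$ means that $\mu$ is finite and Lipschitz continuous on some neighborhood of $x_0$. *)

(* Defs.v *)
From HB Require Import structures.
From mathcomp Require Import all_boot all_order all_algebra.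
From mathcomp Require Import all_classical all_reals all_analysis.

Set Implicit Arguments.
Unset Strict Implicit.
Unset Printing Implicit Defensive.

Import Order.TTheory GRing.Theory Num.Theory.
Import numFieldNormedType.Exports.

Local Open Scope classical_set_scope.
Local Open Scope ring_scope.

(* The library norm `|v| on 'rV[R]_n is the sup norm, hence [enorm]. *)
Definition dot (R : realType) (n : nat) (u v : 'rV[R]_n) : R :=
  \sum_(i < n) u 0 i * v 0 i.

Definition enorm (R : realType) (n : nat) (v : 'rV[R]_n) : R :=
  Num.sqrt (dot v v).

Definition grad (R : realType) (n : nat) (f : 'rV[R]_n -> R) (x : 'rV[R]_n) :
    'rV[R]_n :=
  \row_(i < n) 'D_(delta_mx 0 i) f x.

(* [c] is the arbitrary value given to cm(D, 0).  The supremum is a maximum,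
   since this is only used for D finite and nonempty. *)
Definition cm (R : realType) (n : nat) (c : R) (D : set 'rV[R]_n)
    (v : 'rV[R]_n) : R :=
  if v == 0 then c else sup [set dot d v / (enorm d * enorm v) | d in D].

Definition forcing_function (R : realType) (rho : R -> R) : Prop :=
  [/\ forall a : R, 0 < a -> 0 < rho a,
      forall a b : R, 0 < a -> a <= b -> rho a <= rho b &
      rho =o_ (0^'+) (fun a : R => a)].

Definition borelRV (R : realType) (n : nat) : measurableType _ :=
  g_sigma_algebraType (@open 'rV[R]_n).

Section randomness.
Context {R : realType} {n : nat} {d : measure_display} {T : measurableType d}.
Implicit Types (D : nat -> T -> set 'rV[R]_n) (X : nat -> T -> 'rV[R]_n).

Definition random_vector (Y : T -> 'rV[R]_n) : Prop :=
  measurable_fun [set: T] (Y : T -> borelRV R n).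

(* Random finite sets are measured through the events "S meets B", B Borel.
   If S = {d_1, ..., d_m}, this event is the union of the preimages of B by the
   d_i, so S is a random finite set as soon as the d_i are random vectors; the
   number of elements of S may itself be random. *)
Definition hit (S : T -> set 'rV[R]_n) (B : set 'rV[R]_n) : set T :=
  [set w | S w `&` B !=set0].

Definition random_finite_set (S : T -> set 'rV[R]_n) : Prop :=
  (forall w, finite_set (S w)) /\
  (forall B : set (borelRV R n), measurable B -> measurable (hit S B)).

Definition hit_events (S : T -> set 'rV[R]_n) : set (set T) :=
  hit S @` (measurable : set (set (borelRV R n))).

(* [past D X k] is F_{k-1} = sigma(D_0, X_1, ..., D_{k-1}, X_k); it is the
   trivial sigma-algebra for k = 0. *)
Definition past D X (k : nat) : set (set T) :=
  <<s \bigcup_(j in `I_k)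
        (hit_events (D j) `|`
         preimage_set_system [set: T] (X j.+1 : T -> borelRV R n) measurable) >>.

Definition is_cond_prob (P : probability T R) (G : set (set T)) (E : set T)
    (Z : T -> R) : Prop :=
  [/\ measurable E,
      forall B : set R, measurable B -> G (Z @^-1` B),
      P.-integrable [set: T] (EFin \o Z) &
      forall H, G H -> (\int[P]_(w in H) (Z w)%:E)%E = P (E `&` H)].

Definition probabilistic_ascent (P : probability T R) (f : 'rV[R]_n -> R)
    (c p : R) D X : Prop :=
  forall k, exists2 Z : T -> R,
    is_cond_prob P (past D X k)
      [set w | cm c (D k w) (- grad f (X k w)) <= 0] Z &
    {ae P, forall w, p * \1_[set w' | grad f (X k w') != 0] w <= Z w}.

(* The existential over the directions in [pds_success] is pathwise, so the
   selection rule is arbitrary. *)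
Record PDS (f : 'rV[R]_n -> R) (x0 : 'rV[R]_n) (alpha0 theta gamma : R)
    (rho : R -> R) (D : nat -> T -> set 'rV[R]_n) (X : nat -> T -> 'rV[R]_n)
    (A : nat -> T -> R) : Prop := {
  pds_random_directions : forall k, random_finite_set (D k);
  pds_directions_neq0 : forall k w, D k w !=set0;
  pds_directions_norm1 : forall k w v, D k w v -> enorm v = 1;
  pds_random_iterate : forall k, random_vector (X k);
  pds_random_step : forall k, measurable_fun [set: T] (A k);
  pds_iterate0 : forall w, X 0%N w = x0;
  pds_step0 : forall w, A 0%N w = alpha0;
  pds_success : forall k w,
    (exists2 v, D k w v & f (X k w) - f (X k w + A k w *: v) > rho (A k w)) ->
    (exists v, [/\ D k w v,
                   f (X k w) - f (X k w + A k w *: v) > rho (A k w) &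
                   X k.+1 w = X k w + A k w *: v]) /\
    A k.+1 w = gamma * A k w;
  pds_failure : forall k w,
    ~ (exists2 v, D k w v & f (X k w) - f (X k w + A k w *: v) > rho (A k w)) ->
    X k.+1 w = X k w /\ A k.+1 w = theta * A k w
}.

Definition Psi (P : probability T R) (mu : 'rV[R]_n -> \bar R) (x0 : 'rV[R]_n)
    X (zeta : R) : \bar R :=
  P [set w | ((1 - zeta)%:E * mu x0 <=
              ereal_inf (range (fun k => mu (X k w))))%E].

End randomness.

(* The norm underlying [lipschitz] is the sup norm, which on R^n gives the same
   Lipschitz functions as the Euclidean norm. *)
Definition locally_lipschitz_at (R : realType) (n : nat)
    (mu : 'rV[R]_n -> \bar R) (x0 : 'rV[R]_n) : Prop :=
  exists2 V, nbhs x0 V &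
    (forall x, V x -> mu x \is a fin_num) /\
    [lipschitz fine (mu x) | x in V].

(* Main.v *)
Require Import Defs.
From HB Require Import structures.
From mathcomp Require Import all_boot all_order all_algebra.
From mathcomp Require Import all_classical all_reals all_analysis.
From mathcomp Require Import measurable_realfun ring lra.

Set Implicit Arguments.
Unset Strict Implicit.
Unset Printing Implicit Defensive.

Import Order.TTheory GRing.Theory Num.Theory.
Import numFieldNormedType.Exports.

Local Open Scope classical_set_scope.
Local Open Scope ring_scope.

(** Where the gradient is nonzero, convexity makes every poll along an ascent set
    fail; at a minimizer every poll fails.  Hence, whatever happened before,
    iteration [k] fails with conditional probability at least [p]
    ([prob_failure_ge]).

    The first [K] iterations therefore all fail with probability at least
    [p ^+ K] ([initial_failures]).  On that event the iterate is still [x0] and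
    the step size is [alpha0 * theta ^+ K].  From there on, the assumption on [p]
    makes a small power [s] of the step size contract in mean, even after
    rescaling by a rate [r < 1] close to [1] ([powR_drift]).  By Markov's
    inequality ([step_tail]) and a union bound, with conditional probability at
    least one half the later step sizes are below a geometric sequence of ratio
    [r] starting at a constant multiple of [theta ^+ K]
    ([step_geometric_bound]).  So with probability at least [p ^+ K / 2] no
    iterate leaves the ball of centre [x0] and radius [M * theta ^+ K], where
    [M] does not depend on [K] ([failures_then_small_steps],
    [iterate_dist_sum]).

    In that ball [mu] decreases by at most [L * M * theta ^+ K], with [L] its
    Lipschitz constant.  Let [K] be the first integer for which this is at most
    [zeta * mu x0].  Then [theta ^+ K] is of order [zeta], and
    [p ^+ K = (theta ^+ K) `^ (ln p / ln theta)] is at least a constant times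
    [zeta `^ (ln p / ln theta)]. *)

(** * Convexity and the cosine measure *)

Section euclidean.
Context {R : realType} {n : nat}.
Implicit Types u v : 'rV[R]_n.

Lemma dotZl a u v : dot (a *: u) v = a * dot u v.
Proof. by rewrite /dot mulr_sumr; apply: eq_bigr => i _; rewrite mxE mulrA. Qed.

Lemma dotNr u v : dot u (- v) = - dot u v.
Proof. by rewrite /dot -sumrN; apply: eq_bigr => i _; rewrite mxE mulrN. Qed.

Lemma dot0r u : dot u 0 = 0.
Proof. by rewrite /dot big1 // => i _; rewrite mxE mulr0. Qed.

Lemma dot_ge0 v : 0 <= dot v v.
Proof. by apply: sumr_ge0 => i _; rewrite -expr2 sqr_ge0. Qed.

Lemma enorm_gt0 v : v != 0 -> 0 < enorm v.
Proof.
move=> v0; rewrite sqrtr_gt0 lt_def dot_ge0 andbT.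
apply: contraNneq v0 => /eqP; rewrite psumr_eq0 => [/allP v0|i _].
  apply/eqP/rowP => i; rewrite mxE; apply/eqP.
  by have /implyP/(_ isT) := v0 i (mem_index_enum i); rewrite mulf_eq0 orbb.
by rewrite -expr2 sqr_ge0.
Qed.

Lemma norm_le_enorm v : `|v| <= enorm v.
Proof.
rewrite [leLHS]mx_normrE; apply/bigmax_leP; split; first exact: sqrtr_ge0.
move=> [i j] _ /=; rewrite (ord1 i) -(ler_pXn2r (n := 2)) ?nnegrE ?sqrtr_ge0//.
rewrite sqr_sqrtr ?dot_ge0// real_normK ?num_real// expr2 /dot (bigD1 j)//= lerDl.
by apply: sumr_ge0 => k _; rewrite -expr2 sqr_ge0.
Qed.

Lemma derive_dot_grad (f : 'rV[R]_n -> R) x v :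
  differentiable f x -> 'D_v f x = dot v (grad f x).
Proof.
move=> fx; rewrite deriveE// [in LHS](row_sum_delta v) linear_sum.
by apply: eq_bigr => i _; rewrite linearZ /= mxE deriveE.
Qed.

Lemma convex_ge_tangent (f : 'rV[R]_n -> R) x v :
  differentiable f x -> convex_function [set: 'rV[R]_n] f ->
  f x + dot v (grad f x) <= f (x + v).
Proof.
move=> fx cf; rewrite -derive_dot_grad// addrC -lerBrDr.
have dfx : derivable f x v by exact: diff_derivable.
rewrite /derive cvg_at_rightE//.
apply: limr_le; first by apply: cvgP; exact: (cvg_dnbhs_at_right dfx).
near=> h; have h0 : 0 < h by near: h; exact: nbhs_right_gt.
have h1 : h <= 1 by near: h; apply: nbhs_right_le.
(* The difference quotient at [h <= 1] is at most the one at [1]. *)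
have := cf (Itv01 (ltW h0) h1) (x + v) x; rewrite !inE => /(_ I I).
rewrite [X in f X <= _](_ : _ = h *: v + x); last first.
  rewrite [LHS](_ : _ = h *: (x + v) + (1 - h) *: x)//.
  by rewrite scalerDr scalerBl scale1r addrAC addrCA subrr addr0 addrC.
rewrite convRE /= /unstable.onem => fh.
rewrite /GRing.scale/= mulrC ler_pdivrMr//; lra.
Unshelve. all: by end_near. Qed.

(** Along an ascent set every poll point is at least as high as the centre. *)
Lemma cm_le0_ascent (c : R) (S : set 'rV[R]_n) g v :
  finite_set S -> (forall u, S u -> enorm u = 1) -> g != 0 ->
  cm c S (- g) <= 0 -> S v -> 0 <= dot v g.
Proof.
move=> finS S1 g0; rewrite /cm oppr_eq0 (negbTE g0) => supS Sv.
have Ng0 : 0 < enorm (- g) by rewrite enorm_gt0 ?oppr_eq0.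
pose q u := dot u (- g) / (enorm u * enorm (- g)).
have /ubP/(_ (q v)) : ubound (q @` S) (sup (q @` S)).
  apply: sup_upper_bound; split; first by exists (q v), v.
  have /finite_seqP[s ->] := finite_image q finS.
  exists (\big[Num.max/0]_(y <- s) y) => y /= sy; exact: le_bigmax_seq.
move=> /(_ (ex_intro2 _ _ v Sv erefl)) /le_trans/(_ supS).
by rewrite /q S1// mul1r pmulr_lle0 ?invr_gt0// dotNr oppr_le0.
Qed.

End euclidean.

(** * The drift of the step size *)

Section drift.
Context {R : realType}.

Lemma expR_le_inv (u : R) : u < 1 -> expR u <= (1 - u)^-1.
Proof.
move=> u1; rewrite -[expR u]invrK -expRN lef_pV2 ?posrE ?expR_gt0 ?subr_gt0//.
exact: expR_ge1Dx.
Qed.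

(** The mean of [expR (s * Y)] is below one for small [s > 0] when [Y], equal to
    [L] with probability [1 - p] and to [- T] with probability [p], has negative
    mean. *)
Lemma exp_drift (p L T : R) : 0 <= p -> p <= 1 -> 0 <= L -> 0 < T ->
  (1 - p) * L < p * T ->
  exists2 s, 0 < s & (1 - p) * expR (s * L) + p * expR (s * - T) < 1.
Proof.
move=> p0 p1 L0 T0 drift; set e := p * T - (1 - p) * L.
have e0 : 0 < e by rewrite subr_gt0.
have LT0 : 0 <= L * T by rewrite mulr_ge0 // ltW.
have den0 : 0 < 1 + L * T by lra.
pose s := e / (1 + L * T).
have s0 : 0 < s by rewrite divr_gt0.
have sE : s * (L * T) < e.
  by rewrite /s mulrAC ltr_pdivrMr// ltr_pM2l//; lra.
have sL1 : s * L < 1.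
  rewrite /s mulrAC ltr_pdivrMr// mul1r /e; nra.
exists s => //; set u := s * L in sL1 *; set v := s * T.
have v0 : 0 < v by rewrite mulr_gt0.
have -> : s * - T = - v by rewrite mulrN.
have u0 : 0 <= u by rewrite mulr_ge0// ltW.
have vN1 : - v < 1 by lra.
(* Bounding both exponentials by [expR_le_inv] leaves a quadratic inequality. *)
apply: (@le_lt_trans _ _ ((1 - p) * (1 - u)^-1 + p * (1 - - v)^-1)).
  by rewrite lerD// ler_wpM2l ?subr_ge0// expR_le_inv.
have uv : (1 - p) * u + u * v < p * v.
  have -> : (1 - p) * u + u * v = s * ((1 - p) * L + s * (L * T)).
    by rewrite /u /v; ring.
  have -> : p * v = s * (p * T) by rewrite /v; ring.
  by rewrite ltr_pM2l//; move: sE; rewrite /e; lra.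
rewrite opprK.
have -> : (1 - p) / (1 - u) + p / (1 + v) =
    ((1 - p) * (1 + v) + p * (1 - u)) / ((1 - u) * (1 + v)).
  by field; apply/andP; split; apply: lt0r_neq0; lra.
rewrite ltr_pdivrMr; last by rewrite mulr_gt0; lra.
nra.
Qed.

(** The condition on [p] says that the logarithm of the step size decreases in
    mean when each iteration fails with probability [p]; then a small power of
    the step size, even rescaled by a rate [r < 1] close to [1], contracts in
    mean. *)
Lemma powR_drift (p theta gamma : R) :
  0 <= p -> p <= 1 -> 0 < theta -> theta < 1 -> 1 <= gamma ->
  ln gamma / ln (theta^-1 * gamma) < p ->
  exists s r q : R, [/\ 0 < s, 0 < r < 1, 0 < q < 1 &
    (1 - p) * (gamma / r) `^ s + p * (theta / r) `^ s <= q].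
Proof.
move=> p0 p1 t0 t1 g1; have g0 : 0 < gamma by lra.
have T0 : 0 < - ln theta by rewrite oppr_gt0 ln_lt0// t0.
have L0 : 0 <= ln gamma by exact: ln_ge0.
rewrite lnM ?posrE ?invr_gt0// lnV ?posrE//.
set T := - ln theta in T0 *; set L := ln gamma in L0 *.
rewrite ltr_pdivrMr; last lra.
(* [r] is [expR (- e)], which uses up half of the drift. *)
move=> drift; pose e := (p * T - (1 - p) * L) / 2.
have e0 : 0 < e by rewrite /e; lra.
have p_gt0 : 0 < p.
  rewrite lt_def p0 andbT; apply/eqP => pE; move: drift; rewrite pE; lra.
have [|||s s0 es] := @exp_drift p (L + e) (T - e) p0 p1; first by lra.
- rewrite /e; nra.
- rewrite /e; nra.
have r0 : 0 < expR (- e) by exact: expR_gt0.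
have gr0 : 0 < gamma / expR (- e) by rewrite divr_gt0.
have tr0 : 0 < theta / expR (- e) by rewrite divr_gt0.
exists s, (expR (- e)), ((1 - p) * (gamma / expR (- e)) `^ s +
                         p * (theta / expR (- e)) `^ s); split => //.
  by rewrite r0 expR_lt1 oppr_lt0 e0.
apply/andP; split.
  by rewrite ltr_wpDl ?mulr_ge0 ?subr_ge0 ?powR_ge0// mulr_gt0// powR_gt0.
rewrite /powR !gt_eqF// !lnM ?posrE ?invr_gt0// !lnV ?posrE// !expRK opprK.
by move: es; rewrite opprB -/L addrC [e - T]addrC /T opprK addrC.
Qed.

End drift.

(** * Step sizes driven by adapted failures *)

(** A step size [A] that is multiplied by [gamma] on the success event [S k] and
    by [theta] off it.  The families [G k] stand for the sigma-algebra of the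
    information available before iteration [k]; only their stability under
    splitting along [S k] matters.  The last field is the conditional lower
    bound [p] on the probability of failure, written in integrated form. *)
Record step_process {R : realType} {d : measure_display} {T : measurableType d}
    (P : probability T R) (p theta gamma : R) (G : nat -> set (set T))
    (S : nat -> set T) (A : nat -> T -> R) : Prop := {
  sp_step_measurable : forall k, measurable_fun [set: T] (A k);
  sp_measurable : forall k H, G k H -> measurable H;
  sp_setT : G 0%N [set: T];
  sp_success : forall k H, G k H -> G k.+1 (H `&` S k);
  sp_failure : forall k H, G k H -> G k.+1 (H `&` ~` S k);
  sp_stepS : forall k w, S k w -> A k.+1 w = gamma * A k w;
  sp_stepF : forall k w, ~ S k w -> A k.+1 w = theta * A k w;
  sp_prob_failure : forall k H, G k H -> p * fine (P H) <= fine (P (H `&` ~` S k))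
}.

Section step_process_theory.
Context {R : realType} {d : measure_display} {T : measurableType d}.
Variable P : probability T R.
Implicit Types E F : set T.

Let Pr E : R := fine (P E).

Lemma fine_probE E : measurable E -> P E = (fine (P E))%:E.
Proof. by move=> mE; rewrite fineK// fin_num_measure. Qed.

Lemma fine_prob_split E F : measurable (E `&` F) -> measurable (E `&` ~` F) ->
  Pr E = Pr (E `&` F) + Pr (E `&` ~` F).
Proof.
move=> mEF mEF'; apply: EFin_inj; rewrite EFinD /Pr -!fine_probE//; last first.
  by rewrite -[E](setUIDK _ F) setDE; exact: measurableU.
rewrite -measureU//; first by rewrite -setIUr setUv setIT.
by rewrite setIACA setICr setI0.
Qed.

Lemma fine_prob_le E F : measurable E -> measurable F -> E `<=` F -> Pr E <= Pr F.
Proof.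
by move=> mE mF EF; rewrite -lee_fin /Pr -!fine_probE// le_measure ?inE.
Qed.

Lemma fine_prob_ge0 E : 0 <= Pr E.
Proof. by rewrite fine_ge0. Qed.

Variables (p theta gamma : R) (G : nat -> set (set T)) (S : nat -> set T).
Variables (A : nat -> T -> R).
Hypothesis sp : step_process P p theta gamma G S A.
Hypotheses (p0 : 0 <= p) (p1 : p <= 1) (theta0 : 0 < theta) (theta1 : theta < 1).
Hypothesis (gamma1 : 1 <= gamma).

Let gamma0 : 0 < gamma. Proof. exact: lt_le_trans gamma1. Qed.

Let measurable_ge k (t : R) : measurable [set w | t <= A k w].
Proof.
have := sp_step_measurable sp k measurableT (measurable_itv `[t, +oo[).
by rewrite setTI; congr measurable; apply/seteqP; split => w /=;
  rewrite in_itv/= andbT.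
Qed.

(** Markov's inequality for the contracting power [s] of the rescaled step
    size. *)
Lemma step_tail (s r q : R) : 0 < s -> 0 < r ->
  (1 - p) * (gamma / r) `^ s + p * (theta / r) `^ s <= q ->
  forall j k H (a t : R), G k H -> (forall w, H w -> A k w = a) ->
  0 < a -> 0 < t ->
  Pr (H `&` [set w | t * r ^+ j <= A (k + j)%N w]) <=
  Pr H * (q ^+ j * (a / t) `^ s).
Proof.
move=> s0 r0 uvq; elim=> [|j IH] k H a t GH Ha a0 t0.
  have mH := sp_measurable sp GH.
  rewrite addn0 !expr0 mulr1 mul1r.
  have [ta|ta] := leP t a.
    apply: (@le_trans _ _ (Pr H)).
      by apply: fine_prob_le => //; apply: measurableI.
    have one : 1 `^ s = 1 :> R by rewrite powR1.
    rewrite ler_peMr ?fine_prob_ge0// -[leLHS]one.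
    have s1 : 0 <= s by exact: ltW.
    by rewrite (ge0_ler_powR s1) ?nnegrE ?divr_ge0 ?(ltW a0) ?(ltW t0)// ler_pdivlMr ?mul1r.
  rewrite (_ : _ `&` _ = set0) /Pr ?measure0 ?mulr_ge0 ?fine_ge0 ?powR_ge0//.
  by apply/seteqP; split => // w [/Ha /= ->]; rewrite leNgt ta.
set B := [set w | _ <= _].
have mB : measurable B by exact: measurable_ge.
have GS := sp_success sp GH; have GF := sp_failure sp GH.
have mS := sp_measurable sp GS; have mF := sp_measurable sp GF.
have mSB : measurable (H `&` B `&` S k) by rewrite setIAC; exact: measurableI.
have mFB : measurable (H `&` B `&` ~` S k) by rewrite setIAC; exact: measurableI.
rewrite (fine_prob_split mSB mFB) setIAC [H `&` B `&` _]setIAC.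
have BE : B = [set w | t * r * r ^+ j <= A (k.+1 + j)%N w].
  by rewrite /B exprS mulrA addnS addSn.
have AS w : (H `&` S k) w -> A k.+1 w = gamma * a.
  by move=> [Hw Sw]; rewrite (sp_stepS sp)// Ha.
have AF w : (H `&` ~` S k) w -> A k.+1 w = theta * a.
  by move=> [Hw Sw]; rewrite (sp_stepF sp)// Ha.
have ga0 : 0 < gamma * a by rewrite mulr_gt0.
have ta0 : 0 < theta * a by rewrite mulr_gt0.
have tr0 : 0 < t * r by rewrite mulr_gt0.
have {IH}:= lerD (IH _ _ _ _ GS AS ga0 tr0) (IH _ _ _ _ GF AF ta0 tr0).
rewrite -BE => /le_trans; apply.
have powE c : 0 < c -> (c * a / (t * r)) `^ s = (c / r) `^ s * (a / t) `^ s.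
  move=> c0; rewrite -powRM ?divr_ge0 ?(ltW c0) ?(ltW r0) ?(ltW a0) ?(ltW t0)//.
  congr (_ `^ _).
  by rewrite mulf_div [r * t]mulrC.
rewrite !powE//.
have q0 : 0 <= q.
  by apply: le_trans uvq; rewrite addr_ge0// mulr_ge0 ?subr_ge0 ?powR_ge0.
have := sp_prob_failure sp GH; have := fine_prob_split mS mF.
have uv : (theta / r) `^ s <= (gamma / r) `^ s.
  rewrite (ge0_ler_powR (ltW s0)) ?nnegrE ?divr_ge0 ?(ltW gamma0) ?(ltW r0) ?(ltW theta0)//.
  by rewrite ler_pM2r ?invr_gt0//; apply: le_trans gamma1; exact: ltW.
rewrite -!/(Pr _).
move: uvq uv; set u := (gamma / r) `^ s; set v := (theta / r) `^ s.
move: (fine_prob_ge0 H); set h := Pr H; set x := Pr _; set y := Pr _.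
move=> h0 uvq uv hE yp; set z := (a / t) `^ s.
have -> : x * (q ^+ j * (u * z)) + y * (q ^+ j * (v * z)) =
          (x * u + y * v) * (q ^+ j * z) by ring.
rewrite exprS [h * _](_ : _ = h * q * (q ^+ j * z)); last by ring.
apply: ler_wpM2r; first by rewrite mulr_ge0 ?exprn_ge0 ?powR_ge0.
(* Since [v <= u], the bound is worst when failure has probability exactly
   [p * h]. *)
have -> : x = h - y by rewrite hE; ring.
apply: le_trans (ler_wpM2l h0 uvq).
rewrite -subr_ge0 [leRHS](_ : _ = (y - p * h) * (u - v)); last by ring.
by rewrite mulr_ge0 ?subr_ge0.
Qed.

(** Started from [a], the step size stays below a geometric sequence with
    conditional probability at least one half. *)
Lemma step_geometric_bound (s r q : R) : 0 < s -> 0 < r -> 0 < q < 1 ->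
  (1 - p) * (gamma / r) `^ s + p * (theta / r) `^ s <= q ->
  exists2 M : R, 0 < M &
  forall k H (a : R), G k H -> (forall w, H w -> A k w = a) -> 0 < a ->
  let E := H `&` \bigcap_j [set w | A (k + j)%N w < M * a * r ^+ j] in
  measurable E /\ Pr H / 2 <= Pr E.
Proof.
move=> s0 r0 /andP[q0 q1] uvq.
have c0 : 0 < (1 - q) / 2 by rewrite divr_gt0 ?subr_gt0.
(* [M] makes the bounds of [step_tail] add up to [Pr H / 2] over all [j]. *)
pose M : R := (((1 - q) / 2) `^ s^-1)^-1.
have M0 : 0 < M by rewrite invr_gt0 powR_gt0.
exists M => // k H a GH Ha a0.
have mH := sp_measurable sp GH.
set F := fun j => [set w | A (k + j)%N w < M * a * r ^+ j].
have FC j : ~` F j = [set w | M * a * r ^+ j <= A (k + j)%N w].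
  by apply/seteqP; split => w /=; rewrite leNgt => /negP.
have mFC j : measurable (~` F j) by rewrite FC; exact: measurable_ge.
have mF j : measurable (F j) by rewrite -[F j]setCK; exact: measurableC.
have mFF : measurable (\bigcap_j F j) by exact: bigcapT_measurable.
have mE : measurable (H `&` \bigcap_j F j) by exact: measurableI.
have mE' : measurable (H `&` ~` \bigcap_j F j).
  by apply: measurableI => //; exact: measurableC.
split => //.
have aM : (a / (M * a)) `^ s = (1 - q) / 2.
  rewrite invfM mulrA mulrAC divff ?gt_eqF// mul1r invrK -powRrM mulVf ?gt_eqF//.
  by rewrite powRr1// ltW.
have bad j : (P (H `&` ~` F j) <= (Pr H * ((1 - q) / 2) * q ^+ j)%:E)%E.
  have mHF : measurable (H `&` ~` F j) by exact: measurableI.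
  rewrite fine_probE// lee_fin FC -aM -[leRHS]mulrA [_ `^ _ * _]mulrC.
  exact: (step_tail s0 r0 uvq j GH Ha a0 (mulr_gt0 M0 a0)).
have : (P (H `&` ~` \bigcap_j F j) <= (Pr H / 2)%:E)%E.
  apply: (@le_trans _ _ (\sum_(0 <= j <oo) P (H `&` ~` F j))%E).
    apply: measure_sigma_subadditive => //.
      by move=> j; exact: measurableI.
    by rewrite setC_bigcap setI_bigcupr.
  apply: lime_le; first exact: is_cvg_nneseries.
  apply: nearW => m; apply: (le_trans (lee_sum _ (fun j _ => bad j))).
  rewrite sumEFin lee_fin -[X in X <= _]/(series (geometric _ q) m).
  apply: (le_trans (geometric_le_lim _ _ _ _)) => //.
  - by rewrite mulr_ge0 ?fine_prob_ge0// ltW.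
  - by rewrite ger0_norm// ltW.
  - have q1' : 1 - q != 0 by rewrite subr_eq0 gt_eqF.
    by rewrite le_eqVlt; apply/orP; left; apply/eqP; field.
rewrite fine_probE// lee_fin -/(Pr _) => badE.
have := fine_prob_split mE mE'; lra.
Qed.

Lemma initial_failures k : exists H, [/\ G k H, p ^+ k <= Pr H &
  forall w, H w -> forall i, (i < k)%N -> ~ S i w].
Proof.
elim: k => [|k [H [GH pH HS]]].
  exists [set: T]; split => //; first exact: sp_setT sp.
  by rewrite expr0 /Pr probability_setT.
exists (H `&` ~` S k); split; first exact: sp_failure sp _ _ GH.
  by rewrite exprS; apply: le_trans (sp_prob_failure sp GH); rewrite ler_wpM2l.
move=> w [Hw Sw] i; rewrite ltnS leq_eqVlt => /orP[/eqP->//|]; exact: HS.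
Qed.

(** With probability at least [p ^+ k / 2], the first [k] iterations fail, and
    the step sizes after them have a sum of order [theta ^+ k]. *)
Lemma failures_then_small_steps (alpha0 : R) : 0 < alpha0 ->
  (forall w, A 0%N w = alpha0) ->
  ln gamma / ln (theta^-1 * gamma) < p ->
  exists2 M : R, 0 < M & forall k, exists E, [/\ measurable E,
    p ^+ k / 2 <= Pr E &
    forall w, E w -> (forall i, (i < k)%N -> ~ S i w) /\
      forall m, \sum_(i < m) A (k + i)%N w <= M * theta ^+ k].
Proof.
move=> al0 A0 pgt.
have [s [r [q [s0 /andP[r0 r1] q01 uvq]]]] :=
  powR_drift p0 p1 theta0 theta1 gamma1 pgt.
have [M M0 bound] := step_geometric_bound s0 r0 q01 uvq.
exists (M * alpha0 / (1 - r)); first by rewrite !mulr_gt0 ?invr_gt0 ?subr_gt0.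
move=> k; have [H [GH pH HS]] := initial_failures k.
have Ak w : H w -> A k w = alpha0 * theta ^+ k.
  move=> /HS Sw; elim: k Sw {GH pH HS} => [|k IH] Sw; first by rewrite A0 mulr1.
  rewrite (sp_stepF sp) ?IH//; first by rewrite exprS mulrCA.
    by move=> i ik; apply: Sw; exact: ltnW.
  exact: Sw.
have ak0 : 0 < alpha0 * theta ^+ k by rewrite mulr_gt0 ?exprn_gt0.
have [mE pE] := bound _ _ _ GH Ak ak0.
eexists; split; first exact: mE.
  by apply: le_trans pE; rewrite ler_pM2r.
move=> w [Hw FA]; split; first exact: HS.
move=> m.
apply: (@le_trans _ _ (series (geometric (M * (alpha0 * theta ^+ k)) r) m)).
  by rewrite /series/= big_mkord; apply: ler_sum => i _; apply/ltW/FA.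
apply: (le_trans (geometric_le_lim _ _ _ _)) => //.
- by rewrite ltW// mulr_gt0.
- by rewrite ger0_norm// ltW.
- by rewrite le_eqVlt; apply/orP; left; apply/eqP; ring.
Qed.

End step_process_theory.

(** * Direct search as an adapted step process *)

Section past.
Context {R : realType} {n : nat} {d : measure_display} {T : measurableType d}.
Variables (D : nat -> T -> set 'rV[R]_n) (X : nat -> T -> 'rV[R]_n).

Let gens k : set (set T) := \bigcup_(j in `I_k)
  (hit_events (D j) `|`
   preimage_set_system [set: T] (X j.+1 : T -> borelRV R n) measurable).

(** The space equipped with the sigma-algebra of the past. *)
Let pastT k := g_sigma_algebraType (gens k).

Lemma past_mono k l : (k <= l)%N -> past D X k `<=` past D X l.
Proof.
move=> kl; apply: sub_sigma_algebra2 => A [j /= jk gA].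
by exists j => //=; exact: leq_trans kl.
Qed.

Lemma past_setT k : past D X k [set: T].
Proof. exact: (@measurableT _ (pastT k)). Qed.

Lemma past_setI k A B : past D X k A -> past D X k B -> past D X k (A `&` B).
Proof. exact: (@measurableI _ (pastT k)). Qed.

Lemma past_setC k A : past D X k A -> past D X k (~` A).
Proof. exact: (@measurableC _ (pastT k)). Qed.

Lemma past_measurable k :
  (forall j, random_finite_set (D j)) -> (forall j, random_vector (X j)) ->
  past D X k `<=` measurable.
Proof.
move=> rD rX; apply: smallest_sub; first exact: sigma_algebra_measurable.
move=> A [j _ [[B mB <-]|[B mB <-]]]; first by have [_] := rD j; exact.
exact: rX.
Qed.

Variable x0 : 'rV[R]_n.
Hypothesis X0 : forall w, X 0%N w = x0.

Lemma past_iterate k j (B : set (borelRV R n)) : (j <= k)%N ->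
  measurable B -> past D X k (X j @^-1` B).
Proof.
move=> jk mB; case: j jk => [_|j jk].
  have [Bx0|Bx0] := pselect (B x0).
    rewrite (_ : _ @^-1` _ = [set: T]); first exact: past_setT.
    by apply/seteqP; split => // w _ /=; rewrite X0.
  rewrite (_ : _ @^-1` _ = ~` [set: T]); first by apply: past_setC; exact: past_setT.
  by apply/seteqP; split => w /=; rewrite X0 // => /(_ I).
apply: sub_sigma_algebra; exists j => //=; right; exists B => //.
by rewrite setTI.
Qed.

(** The generated sigma-algebra is that of a measurable type, on which the
    comparison of real measurable functions is available. *)
Lemma past_lt (f : 'rV[R]_n -> R) k i j : continuous f -> (i <= k)%N ->
  (j <= k)%N -> past D X k [set w | f (X i w) < f (X j w)].
Proof.
move=> cf ik jk.
have mfX l : (l <= k)%N -> measurable_fun [set: pastT k] (f \o X l).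
  move=> lk; apply: (measurability (RGenOpens.G (R := R))).
    exact: RGenOpens.measurableE.
  move=> _ [_ [a [b ->]] <-].
  rewrite setTI comp_preimage; apply: past_iterate => //.
  by apply: sub_sigma_algebra; apply: open_comp => [x _|]; [exact: cf|exact: interval_open].
have := @measurable_fun_ltr _ (pastT k) R setT _ _
  (mfX i ik) (mfX j jk) measurableT [set true] I.
by rewrite setTI.
Qed.

End past.

Section pds_theory.
Context {R : realType} {n : nat} {d : measure_display} {T : measurableType d}.
Context {P : probability T R}.
Context {f : 'rV[R]_n -> R} {x0 : 'rV[R]_n} {alpha0 theta gamma : R}.
Context {rho : R -> R} {c p : R}.
Context {D : nat -> T -> set 'rV[R]_n} {X : nat -> T -> 'rV[R]_n}.
Context {A : nat -> T -> R}.
Hypotheses (alpha0_gt0 : 0 < alpha0) (theta_gt0 : 0 < theta).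
Hypotheses (gamma_ge1 : 1 <= gamma) (rho_gt0 : forall a : R, 0 < a -> 0 < rho a).
Hypothesis pds : PDS f x0 alpha0 theta gamma rho D X A.

(** Iteration [k] succeeds exactly when it decreases the objective. *)
Definition success k : set T := [set w | f (X k.+1 w) < f (X k w)].

(** Some poll point achieves the sufficient decrease. *)
Let polled k w := exists2 v, D k w v & f (X k w) - f (X k w + A k w *: v) > rho (A k w).

Lemma step_gt0 k w : 0 < A k w.
Proof.
elim: k => [|k IH]; first by rewrite (pds_step0 pds).
have [/(pds_success pds)[_ ->]|/(pds_failure pds)[_ ->]] := pselect (polled k w).
  by rewrite mulr_gt0// (lt_le_trans _ gamma_ge1).
by rewrite mulr_gt0.
Qed.

Lemma successP k w : success k w -> A k.+1 w = gamma * A k w /\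
  exists v, [/\ D k w v, f (X k w + A k w *: v) < f (X k w) &
                X k.+1 w = X k w + A k w *: v].
Proof.
rewrite /success/=.
have [/(pds_success pds)[[v [Dv fv ->]] ->] _|] := pselect (polled k w).
  split=> //; exists v; split => //; rewrite -subr_gt0.
  by apply: lt_trans fv; exact/rho_gt0/step_gt0.
by move=> /(pds_failure pds)[-> _]; rewrite ltxx.
Qed.

Lemma failureP k w : ~ success k w ->
  A k.+1 w = theta * A k w /\ X k.+1 w = X k w.
Proof.
rewrite /success/=.
have [/(pds_success pds)[[v [Dv fv ->]] _]|] := pselect (polled k w).
  by case; rewrite -subr_gt0; apply: lt_trans fv; exact/rho_gt0/step_gt0.
by move=> /(pds_failure pds)[-> ->].
Qed.

Lemma displacement_le k w : `|X k.+1 w - X k w| <= A k w.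
Proof.
have [/successP[_ [v [Dv _ ->]]]|/failureP[_ ->]] := pselect (success k w).
  rewrite addrAC subrr add0r mx_normZ gtr0_norm ?step_gt0//.
  rewrite ler_piMr ?(ltW (step_gt0 _ _))//.
  by rewrite -(pds_directions_norm1 pds Dv) norm_le_enorm.
by rewrite subrr normr0 ltW// step_gt0.
Qed.

Lemma iterate_initial K w : (forall i, (i < K)%N -> ~ success i w) ->
  forall m, (m <= K)%N -> X m w = x0.
Proof.
move=> fail; elim=> [_|m IH mK]; first exact: (pds_iterate0 pds).
by have [_ ->] := failureP (fail _ mK); apply: IH; exact: ltnW.
Qed.

Lemma iterate_dist_sum K w : (forall i, (i < K)%N -> ~ success i w) ->
  forall m, `|X (K + m)%N w - x0| <= \sum_(i < m) A (K + i)%N w.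
Proof.
move=> fail; elim=> [|m IH].
  by rewrite addn0 (iterate_initial fail)// subrr normr0 big_ord0.
rewrite big_ord_recr/= addnS -[X in `|X|](subrKA (X (K + m)%N w)) addrC.
by apply: le_trans (ler_normD _ _) _; rewrite lerD// displacement_le.
Qed.

Hypothesis f_diff : forall x, differentiable f x.
Hypothesis f_convex : convex_function [set: 'rV[R]_n] f.

Let f_cont : continuous f.
Proof. by move=> x; exact: differentiable_continuous. Qed.

(** The points that are not global minimizers of [f].  This set is open, hence
    Borel, and the gradient does not vanish on it. *)
Let nonmin : set 'rV[R]_n := \bigcup_y [set x | f y < f x].

Let open_nonmin : open nonmin.
Proof.
apply: bigcup_open => y _.
by apply: (open_comp (D := [set z | f y < z])) => [x _|]; [exact: f_cont|exact: open_gt].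
Qed.

Let nonmin_grad x : nonmin x -> grad f x != 0.
Proof.
move=> [y _ /= fyx]; apply/eqP => gx.
have := convex_ge_tangent (y - x) (f_diff x) f_convex.
by rewrite gx dot0r addr0 addrC subrK leNgt fyx.
Qed.

Lemma ascent_failure k w :
  nonmin (X k w) -> cm c (D k w) (- grad f (X k w)) <= 0 -> ~ success k w.
Proof.
move=> /nonmin_grad g0 cm0 /successP[_ [v [Dv fv _]]].
have [finD _] := pds_random_directions pds k.
have unitD u : D k w u -> enorm u = 1 by exact: (pds_directions_norm1 pds).
have dv := cm_le0_ascent (finD w) unitD g0 cm0 Dv.
have := convex_ge_tangent (A k w *: v) (f_diff (X k w)) f_convex.
rewrite dotZl leNgt; apply/negP; rewrite negbK; apply: lt_le_trans fv _.
by rewrite lerDl mulr_ge0// ltW// step_gt0.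
Qed.

Hypotheses (p_ge0 : 0 <= p) (p_le1 : p <= 1).
Hypothesis D_ascent : probabilistic_ascent P f c p D X.

Let mpast k H : past D X k H -> measurable H.
Proof.
apply: past_measurable; first exact: (pds_random_directions pds).
exact: (pds_random_iterate pds).
Qed.

Let past_nonmin k : past D X k [set w | nonmin (X k w)].
Proof.
apply: (past_iterate (pds_iterate0 pds) (leqnn k)).
by apply: sub_sigma_algebra; exact: open_nonmin.
Qed.

Let past_success k : past D X k.+1 (success k).
Proof. exact: past_lt (pds_iterate0 pds) _ _ _ _ f_cont _ _. Qed.

(** The conditional bound integrated over an event of the past on which the
    iterate is not a global minimizer. *)
Lemma prob_ascent_ge k H : past D X k H -> H `<=` [set w | nonmin (X k w)] ->
  (p%:E * P H <= P ([set w | (cm c (D k w) (- grad f (X k w)) <= 0)%R] `&` H))%E.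
Proof.
move=> GH HN; have mH := mpast GH.
have [Z [_ _ iZ PZ] pZ] := D_ascent k.
rewrite -PZ// -integral_cst//.
pose Y w : \bar R := maxe (Z w)%:E p%:E.
have mZ : measurable_fun H (EFin \o Z : T -> \bar R).
  exact/measurable_funTS/(measurable_int P iZ).
have mpp : measurable_fun H (cst p%:E : T -> \bar R) by exact: measurable_cst.
have mY : measurable_fun H Y.
  exact: measurable_maxe.
(* [Z] may be below [p] on a null set, so it is replaced by its maximum with
   [p]. *)
rewrite (ae_eq_integral Y _ mH mZ mY); last first.
  apply: filterS pZ => w + Hw; rewrite indicE mem_set ?mulr1; last first.
    exact/nonmin_grad/HN.
  by move=> pz; rewrite /Y max_l// lee_fin.
apply: ge0_le_integral => // w _.
by rewrite /Y le_max lexx orbT.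
Qed.

Lemma prob_failure_ge k H : past D X k H ->
  p * fine (P H) <= fine (P (H `&` ~` success k)).
Proof.
move=> GH; set N := [set w | nonmin (X k w)].
have GN : past D X k N by exact: past_nonmin.
have GHN := past_setI GH GN; have GHN' := past_setI GH (past_setC GN).
have mS : measurable (success k) by exact: mpast (@past_success k).
have mF : measurable (H `&` ~` success k).
  by apply: measurableI; [exact: mpast GH|exact: measurableC].
have mN := mpast GN; have mNC := measurableC mN.
rewrite (fine_prob_split P (mpast GHN) (mpast GHN')) mulrDr.
rewrite [leRHS](fine_prob_split P (measurableI _ _ mF mN) (measurableI _ _ mF mNC)).
have [Z [mcm _ _ _] _] := D_ascent k.
apply: lerD.
  have sub : H `&` N `<=` N by move=> w [].
  have := prob_ascent_ge GHN sub.
  have mcmH := measurableI _ _ mcm (mpast GHN).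
  rewrite (fine_probE _ (mpast GHN)) (fine_probE _ mcmH) -EFinM lee_fin.
  move=> /le_trans; apply; apply: fine_prob_le => //; first exact: measurableI.
  by move=> w [cm0 [Hw Nw]]; split => //; split => //; exact: ascent_failure.
(* At a minimizer the iteration fails surely. *)
apply: (@le_trans _ _ (fine (P (H `&` ~` N)))).
  by rewrite ler_piMl ?fine_prob_ge0.
apply: fine_prob_le; [exact: mpast GHN'|exact: measurableI|].
move=> w [Hw Nw]; split => //; split => // Sw; apply: Nw.
by exists (X k.+1 w).
Qed.

Lemma pds_step_process : step_process P p theta gamma (past D X) success A.
Proof.
split.
- exact: (pds_random_step pds).
- exact: mpast.
- exact: past_setT.
- by move=> k H GH; apply: past_setI (@past_success k); exact: past_mono GH.
- move=> k H GH; apply: past_setI (past_setC (@past_success k)).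
  exact: past_mono GH.
- by move=> k w /successP[].
- by move=> k w /failureP[].
- exact: prob_failure_ge.
Qed.

End pds_theory.

(** * Level events and local bounds of the function mu *)

Section levels.
Context {R : realType} {n : nat} {d : measure_display} {T : measurableType d}.
Variables (mu : 'rV[R]_n -> \bar R) (X : nat -> T -> 'rV[R]_n).

Lemma measurable_inf_ge (t : R) : lower_semicontinuous mu ->
  (forall k, random_vector (X k)) ->
  measurable [set w | (t%:E <= ereal_inf (range (fun k => mu (X k w))))%E].
Proof.
move=> /lower_semicontinuousP oU rX.
(* The set where [mu >= t] is the intersection of the open sets where
   [mu > t - 1 / (j + 1)]. *)
pose U j : set 'rV[R]_n := [set x | ((t - j.+1%:R^-1)%:E < mu x)%E].
rewrite (_ : mkset _ = \bigcap_k \bigcap_j (X k @^-1` U j)).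
  apply: bigcapT_measurable => k; apply: bigcapT_measurable => j.
  rewrite -[X in measurable X]setTI; apply: rX => //.
  by apply: sub_sigma_algebra; exact: oU.
apply/seteqP; split => w /=.
  move=> tinf k _ j _ /=; apply: (@lt_le_trans _ _ t%:E).
    by rewrite lte_fin ltrBlDr ltrDl invr_gt0.
  by apply: le_trans tinf _; apply: ereal_inf_lbound; exists k.
move=> tX; apply: le_ereal_inf_tmp => _ [k _ <-].
have {}tX j : ((t - j.+1%:R^-1)%:E < mu (X k w))%E by exact: tX.
case: (mu (X k w)) tX => [y| |] tX; last by have := tX 0%N.
  rewrite lee_fin; apply/ler_addgt0Pr => e e0.
  have [j je] := ltr_add_invr (y := 0) (x := e) e0.
  have := tX j; rewrite lte_fin ltrBlDr => tj; apply/ltW/(lt_trans tj).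
  by rewrite ltrD2l; move: je; rewrite add0r.
by rewrite leey.
Qed.

(** Only the lower bound on [mu] implied by the Lipschitz condition, with one of
    the two points at the centre, is kept. *)
Lemma locally_lipschitz_bound (x0 : 'rV[R]_n) : locally_lipschitz_at mu x0 ->
  exists L r : R, [/\ 0 < L, 0 < r & forall x, `|x - x0| < r ->
    mu x \is a fin_num /\ fine (mu x0) - L * `|x - x0| <= fine (mu x)].
Proof.
move=> [V Vx0 [finV lipV]].
have [L [L0 lipL]] : exists L : R, 0 < L /\
    L.-lipschitz_on (fun x => fine (mu x)) (globally (V `*` V)).
  have [L []] := filter_ex (filterI (nbhs_pinfty_gt (num_real (0 : R))) lipV).
  by exists L.
have /nbhs_ballP[r /= r0 rV] := Vx0.
exists L, r; split => // x xr.
have Vx : V x by apply: rV; rewrite -ball_normE /= distrC.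
split; first exact: finV.
have := lipL (x, x0) (conj Vx (nbhs_singleton Vx0)) => /=.
by rewrite ler_norml => /andP[+ _]; lra.
Qed.

End levels.

(** * The bound on the probability *)

(** The first power of [theta] below [e] is within a factor [theta] of [e]. *)
Lemma first_small_power {R : realType} (theta e : R) :
  0 < theta -> theta < 1 -> 0 < e -> e < 1 ->
  exists k, theta * e < theta ^+ k <= e.
Proof.
move=> t0 t1 e0 e1.
have ex : exists k, theta ^+ k <= e.
  have c : (GRing.exp theta : R ^nat) @ \oo --> (0 : R).
    by apply: cvg_expr; rewrite ger0_norm// ltW.
  have [k _ kP] := cvgr_lt _ c e e0.
  by exists k; apply/ltW/(kP k)/leqnn.
case: (ex_minnP ex) => [[|k]] ke kmin; first by move: ke; rewrite leNgt e1.
exists k.+1; rewrite ke andbT exprS ltr_pM2l// ltNge.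
by apply/negP => /kmin; rewrite ltnn.
Qed.

Theorem theorem3p3 (R : realType) (n : nat) (n_ge1 : (1 <= n)%N)
    (d : measure_display) (Omega : measurableType d) (P : probability Omega R)
    (f : 'rV[R]_n -> R) (x0 : 'rV[R]_n) (alpha0 theta gamma : R)
    (rho : R -> R) (c p : R)
    (D : nat -> Omega -> set 'rV[R]_n) (X : nat -> Omega -> 'rV[R]_n)
    (A : nat -> Omega -> R) (mu : 'rV[R]_n -> \bar R)
    (alpha0_gt0 : 0 < alpha0)
    (theta_gt0 : 0 < theta) (theta_lt1 : theta < 1)
    (gamma_ge1 : 1 <= gamma)
    (rho_forcing : forcing_function rho)
    (c_geN1 : -1 <= c) (c_le1 : c <= 1)
    (f_diff : forall x, differentiable f x)
    (f_convex : convex_function [set: 'rV[R]_n] f)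
    (XA_pds : PDS f x0 alpha0 theta gamma rho D X A)
    (p_ge0 : 0 <= p) (p_le1 : p <= 1)
    (D_ascent : probabilistic_ascent P f c p D X)
    (p_gt : ln gamma / ln (theta^-1 * gamma) < p)
    (mu_gtNy : forall x, (-oo < mu x)%E)
    (mu_lsc : lower_semicontinuous mu)
    (mu_x0_gt0 : (0 < mu x0)%E)
    (mu_lip : locally_lipschitz_at mu x0) :
  exists C zetabar : R, [/\ 0 < C, 0 < zetabar &
    forall zeta : R, 0 < zeta -> zeta < zetabar ->
      ((C * zeta `^ (ln p / ln theta))%:E <= Psi P mu x0 X zeta)%E].
Proof.
have [rho_gt0 _ _] := rho_forcing.
have p_gt0 : 0 < p.
  apply: le_lt_trans p_gt; rewrite divr_ge0 ?ln_ge0//.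
  by rewrite -[leLHS]mulr1 ler_pM// invf_ge1// ltW.
have lnt0 : ln theta < 0 by rewrite ln_lt0// theta_gt0.
set q := ln p / ln theta.
have q_ge0 : 0 <= q by rewrite mulr_le0// ?ln_le0// invr_le0 ltW.
have thetaq : theta `^ q = p.
  by rewrite /powR gt_eqF// /q divfK ?lt_eqF// lnK.
have [L [r [L0 r0 lipL]]] := locally_lipschitz_bound mu_lip.
have fin0 : mu x0 \is a fin_num.
  by have [] := lipL x0; rewrite ?subrr ?normr0.
set m0 := fine (mu x0).
have m0E : mu x0 = m0%:E by rewrite /m0 fineK.
have m0_gt0 : 0 < m0 by rewrite -lte_fin -m0E.
have sp := pds_step_process alpha0_gt0 theta_gt0 gamma_ge1 rho_gt0 XA_pds
  f_diff f_convex p_ge0 p_le1 D_ascent.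
have [M M0 steps] := failures_then_small_steps sp p_ge0 p_le1 theta_gt0
  theta_lt1 gamma_ge1 alpha0_gt0 (pds_step0 XA_pds) p_gt.
(* With this [kappa], [theta ^+ K <= kappa * zeta] means
   [L * (M * theta ^+ K) <= zeta * mu x0].  The first bound on [zeta] makes
   [kappa * zeta < 1], the second keeps the iterates in the ball of radius
   [r]. *)
pose kappa := m0 / (M * L).
have kappa0 : 0 < kappa by rewrite divr_gt0// mulr_gt0.
exists ((kappa * theta) `^ q / 2), (Num.min kappa^-1 (r * L / m0)).
split.
- by rewrite divr_gt0// powR_gt0// mulr_gt0.
- by rewrite lt_min invr_gt0 kappa0 divr_gt0// mulr_gt0.
move=> z z0; rewrite lt_min => /andP[zk zr].
have kz0 : 0 < kappa * z by rewrite mulr_gt0.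
have kz1 : kappa * z < 1 by rewrite mulrC -ltr_pdivlMr// div1r.
have [K /andP[Kgt Kle]] := first_small_power theta_gt0 theta_lt1 kz0 kz1.
have [E [mE PE EP]] := steps K.
have pK : (kappa * theta) `^ q * z `^ q <= p ^+ K.
  rewrite -powRM ?(ltW z0)//; last by rewrite ltW// mulr_gt0.
  have -> : p ^+ K = (theta ^+ K) `^ q.
    rewrite -thetaq -powR_mulrn ?powR_ge0// -powRrM mulrC powRrM.
    by rewrite powR_mulrn// ltW.
  apply: (ge0_ler_powR q_ge0); rewrite ?nnegrE ?exprn_ge0 ?(ltW theta_gt0)//.
    by apply/ltW; rewrite mulr_gt0// mulr_gt0.
  by rewrite mulrAC [_ * theta]mulrC ltW.
have MK : M * theta ^+ K <= m0 * z / L.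
  apply: (le_trans (ler_wpM2l (ltW M0) Kle)).
  rewrite le_eqVlt; apply/orP; left; apply/eqP; rewrite /kappa.
  by field; rewrite !gt_eqF.
apply: (@le_trans _ _ (P E)).
  rewrite fine_probE// lee_fin mulrAC; apply: le_trans PE.
  by rewrite ler_pM2r.
apply: le_measure; rewrite ?inE//.
  rewrite m0E -EFinM; apply: measurable_inf_ge => //.
  exact: (pds_random_iterate XA_pds).
move=> w /EP[fails sumA] /=; apply: le_ereal_inf_tmp => _ [k _ <-].
have dist : `|X k w - x0| <= m0 * z / L.
  have [kK|/ltnW/subnKC <-] := leqP k K.
    rewrite (iterate_initial alpha0_gt0 theta_gt0 gamma_ge1 rho_gt0 XA_pds fails kK).
    by rewrite subrr normr0 divr_ge0 ?mulr_ge0// ltW.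
  apply: le_trans MK; apply: le_trans (sumA _).
  exact: (iterate_dist_sum alpha0_gt0 theta_gt0 gamma_ge1 rho_gt0 XA_pds).
have [] := lipL (X k w).
  apply: le_lt_trans dist _; rewrite ltr_pdivrMr//.
  by rewrite mulrC -ltr_pdivlMr.
move=> fink; rewrite -/m0 => muk; rewrite m0E -(fineK fink) -EFinM lee_fin.
by apply: le_trans muk; move: dist; rewrite ler_pdivlMr//; lra.
Qed.
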